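(* Let $Z,B,Y,C:\mathbb{R}\to\mathbb{R}$ be continuous functions satisfying $Z(0)=B(0)=Y(0)=C(0)=0$ and $$\lim_{t\to\pm\infty}(B(t)-Z(t))=\lim_{t\to\pm\infty}(C(t)-Y(t))=\mp\infty.$$ Then $$Y=D(Z,B)\ \text{ and }\ C=R(Z,B)\qquad\text{if and only if}\qquad Z=\overleftarrow{D}(Y,C)\ \text{ and }\ B=\overleftarrow{R}(Y,C),$$ where equalities denote equality as functions of $t\in\mathbb{R}$. If either of these equivalent conditions is satisfied, then also $Q(Z,B)=\overleftarrow{Q}(Y,C)$.
   Context: For $f:\mathbb{R}\to\mathbb{R}$ write $f(s,t)=f(t)-f(s)$. For $Z,B$ with $\limsup_{s\to\infty}(B(s)-Z(s))=-\infty$: $$Q(Z,B)(t)=\sup_{t\le s<\infty}\{B(t,s)-Z(t,s)\},$$ $$D(Z,B)(t)=Z(t)+Q(Z,B)(0)-Q(Z,B)(t),\qquad R(Z,B)(t)=B(t)+Q(Z,B)(t)-Q(Z,B)(0).$$ For $Y,C$ with $\limsup_{s\to-\infty}(Y(s)-C(s))=-\infty$: $$\overleftarrow{Q}(Y,C)(t)=\sup_{-\infty<s\le t}\{C(s,t)-Y(s,t)\},$$ $$\overleftarrow{D}(Y,C)(t)=Y(t)+\overleftarrow{Q}(Y,C)(t)-\overleftarrow{Q}(Y,C)(0),\qquad \overleftarrow{R}(Y,C)(t)=C(t)+\overleftarrow{Q}(Y,C)(0)-\overleftarrow{Q}(Y,C)(t).$$ *)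

(* Defs.v *)
From HB Require Import structures.
From mathcomp Require Import all_boot all_order all_algebra.
From mathcomp Require Import all_classical all_reals all_analysis.
Set Implicit Arguments.
Unset Strict Implicit.
Unset Printing Implicit Defensive.
Import Order.TTheory GRing.Theory Num.Theory.
Import numFieldNormedType.Exports.
Local Open Scope classical_set_scope.
Local Open Scope ring_scope.

(* [incr f s t] is the increment f(s,t) = f(t) - f(s); [queue], [departure],
   [dual_service] are Q, D, R, and the [rev_] versions are Q, D, R with a left
   arrow. *)
Definition incr (R : realType) (f : R -> R) (s t : R) : R := f t - f s.

(* The library's real [sup] is 0 on sets that are empty or not bounded above.
   For continuous functions with B(s) - Z(s) --> -oo as s --> +oo (resp.
   Y(s) - C(s) --> -oo as s --> -oo) the sets below are nonempty and bounded
   above, so these are genuine suprema. *)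
Definition queue (R : realType) (Z B : R -> R) (t : R) : R :=
  sup [set incr B t s - incr Z t s | s in [set s | t <= s]].

Definition departure (R : realType) (Z B : R -> R) (t : R) : R :=
  Z t + queue Z B 0 - queue Z B t.

Definition dual_service (R : realType) (Z B : R -> R) (t : R) : R :=
  B t + queue Z B t - queue Z B 0.

Definition rev_queue (R : realType) (Y C : R -> R) (t : R) : R :=
  sup [set incr C s t - incr Y s t | s in [set s | s <= t]].

Definition rev_departure (R : realType) (Y C : R -> R) (t : R) : R :=
  Y t + rev_queue Y C t - rev_queue Y C 0.

Definition rev_dual_service (R : realType) (Y C : R -> R) (t : R) : R :=
  C t + rev_queue Y C 0 - rev_queue Y C t.

(* Main.v *)
Require Import Defs.
From HB Require Import structures.
From mathcomp Require Import all_boot all_order all_algebra.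
From mathcomp Require Import all_classical all_reals all_analysis.
From mathcomp Require Import lra.
Set Implicit Arguments.
Unset Strict Implicit.
Unset Printing Implicit Defensive.
Import Order.TTheory GRing.Theory Num.Theory.
Import numFieldNormedType.Exports.
Local Open Scope classical_set_scope.
Local Open Scope ring_scope.

(** Put [U t := B t - Z t] and [M t := sup_(s >= t) U s], so that
    [queue Z B t = M t - U t].  If [Y] and [C] are the departure and dual
    service processes of [(Z, B)], then [C - Y] is [2 M - U] up to an additive
    constant, hence [rev_queue Y C t] is [2 M t - U t] minus the infimum of
    [2 M - U] over [s <= t].  The heart of the proof is Pitman's identity: this
    infimum is [M t].  It is a lower bound since [U <= M] and [M] is
    nonincreasing; it is attained at the last [s <= t] where [U] is at least
    [M t], for there [U s = M s = M t] ([last_visit]).  Thus the two queues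
    coincide ([rev_queue_departure]), and the definitions of departure and dual
    service can be solved for [Z] and [B] ([rev_departureK]).

    The converse implication is the same fact read backwards in time: reversal
    [t |-> - t] turns [(Y, C)] into the pair whose arrivals are the reversed [C]
    and whose services are the reversed [Y], exchanging the forward and backward
    operators and, with them, departures and dual services
    ([rev_queueE], [queueE]). *)

(** * Maxima over half-lines *)

Lemma sup_greatest (R : realType) (E : set R) (x : R) :
  E x -> ubound E x -> sup E = x.
Proof.
move=> Ex ubx; apply/le_anti/andP; split; first by apply: ge_sup => //; exists x.
by apply: ub_le_sup => //; exists x.
Qed.

Lemma tail_max (R : realType) (U : R -> R) (t : R) :
  continuous U -> U r @[r --> +oo] --> -oo ->
  exists2 m, t <= m & forall s, t <= s -> U s <= U m.
Proof.
move=> cU /cvgrNy_le /(_ (U t)) [N [_ HN]].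
have tN : t <= Num.max t N by rewrite le_max lexx.
have [m] := EVT_max tN (continuous_subspaceT cU).
rewrite in_itv /= => /andP[tm _] maxm; exists m => // s ts.
have [sN|Ns] := leP s (Num.max t N).
  by apply: maxm; rewrite in_itv /= ts.
apply: (@le_trans _ _ (U t)); last by apply: maxm; rewrite in_itv /= lexx.
by apply: HN; move: Ns; rewrite gt_max => /andP[].
Qed.

(** The point sought is the last [s <= t] where [U >= v]. Between [s] and [t]
    the value [v] is taken by continuity, and by the choice of [s] this can only
    happen at [s] itself; after [s], [U] is below [v] up to [t] by that choice
    and at most [v] beyond [t] by hypothesis. *)
Lemma last_visit (R : realType) (U : R -> R) (t v : R) :
  continuous U -> U r @[r --> -oo] --> +oo ->
  (forall s, t <= s -> U s <= v) ->
  exists2 s, s <= t & U s = v /\ forall r, s <= r -> U r <= v.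
Proof.
move=> cU /cvgry_ge /(_ v) [N [_ HN]] Uv.
pose A : set R := [set r | v <= U r] `&` [set r | r <= t].
have A0 : A !=set0.
  exists (Num.min (N - 1) t); split => /=; last by rewrite ge_min lexx orbT.
  by apply: HN; rewrite gt_min ltrBlDr ltrDl ltr01.
have hA : has_ubound A by exists t => r [].
have clA : closed A.
  apply: closedI; last exact: closed_le.
  by apply: (@preimage_closed _ _ U [set x | v <= x]) => //; exact: closed_ge.
have [vs st] := clA _ (closure_sup A0 hA).
have upA r : A r -> r <= sup A by move=> Ar; exact: ub_le_sup.
exists (sup A) => //; set s0 := sup A in vs st upA *.
have Us : U s0 = v.
  have [c] : exists2 c, c \in `[s0, t] & U c = v.
    apply: IVT => //; first exact: continuous_subspaceT.
    by rewrite ge_min le_max vs (Uv t) ?orbT.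
  rewrite in_itv /= => /andP[sc ct] Uc.
  suff -> : s0 = c by [].
  by apply/le_anti; rewrite sc upA //; split => //=; rewrite Uc.
split=> // r sr; have [tr|rt] := leP t r; first exact: Uv.
rewrite leNgt; apply/negP => vr.
have rs : r <= s0 by apply: upA; split; apply/ltW.
have e : r = s0 by apply/le_anti; rewrite rs sr.
by move: vr; rewrite e Us ltxx.
Qed.

(** * The forward queue and its inversion *)

Section Forward.
Context (R : realType) (Z B : R -> R).
Hypotheses (cZ : continuous Z) (cB : continuous B).
Hypothesis BZ_pinfty : (B t - Z t) @[t --> +oo] --> -oo.
Hypothesis BZ_ninfty : (B t - Z t) @[t --> -oo] --> +oo.

Let U (t : R) := B t - Z t.

Let cU : continuous U.
Proof. by move=> x; apply: continuousB; [exact: cB|exact: cZ]. Qed.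

(** Any level that is reached and not exceeded by [B - Z] after [t] is the
    maximum there, whatever the point where it is reached. *)
Lemma queue_eq (t m : R) : t <= m ->
  (forall s, t <= s -> U s <= U m) -> queue Z B t = U m - U t.
Proof.
move=> tm maxm; apply: sup_greatest.
  by exists m => //; rewrite /incr /U; lra.
by move=> _ [s /= ts <-]; have := maxm _ ts; rewrite /incr /U; lra.
Qed.

(** The function [U + queue Z B] is the running maximum [M]; the bound is
    [U s + M t <= 2 M s] for [s <= t], and the last visit of [U] to the level
    [M t] gives equality. *)
Lemma rev_queue_departure :
  rev_queue (departure Z B) (dual_service Z B) = queue Z B.
Proof.
apply/funext => t; apply: sup_greatest.
  have [m tm maxm] := tail_max t cU BZ_pinfty.
  have [s st [Us maxs]] := last_visit cU BZ_ninfty maxm.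
  exists s => //=.
  have -> : queue Z B t = U m - U t by exact: queue_eq.
  rewrite /incr /departure /dual_service (queue_eq tm maxm).
  (* [s] realises its own maximum over the future: the queue is empty there. *)
  have -> : queue Z B s = U s - U s by apply: queue_eq => // r /maxs; rewrite Us.
  by rewrite subrr; move: Us; rewrite /U; lra.
move=> _ [s /= st <-]; rewrite /incr /departure /dual_service.
have [m tm maxm] := tail_max t cU BZ_pinfty.
have [n sn maxn] := tail_max s cU BZ_pinfty.
rewrite (queue_eq tm maxm) (queue_eq sn maxn).
have := maxn _ (le_trans st tm); have := maxn _ (lexx s).
by rewrite /U; lra.
Qed.

Lemma rev_departureK :
  rev_departure (departure Z B) (dual_service Z B) = Z /\
  rev_dual_service (departure Z B) (dual_service Z B) = B.
Proof.
rewrite /rev_departure /rev_dual_service rev_queue_departure.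
by split; apply/funext => t; rewrite /departure /dual_service; lra.
Qed.

End Forward.

(** * Time reversal *)

Lemma rev_queueE (R : realType) (Y C : R -> R) (t : R) :
  rev_queue Y C t = queue (C \o -%R) (Y \o -%R) (- t).
Proof.
rewrite /rev_queue /queue; congr sup; apply/seteqP; split => _ [s /= st <-];
  exists (- s); rewrite /incr /= ?opprK; lra.
Qed.

Lemma queueE (R : realType) (Z B : R -> R) (t : R) :
  queue Z B t = rev_queue (B \o -%R) (Z \o -%R) (- t).
Proof.
by rewrite rev_queueE opprK; congr (queue _ _ t); apply/funext => s /=;
  rewrite opprK.
Qed.

Lemma departure_reversal (R : realType) (Y C : R -> R) :
  departure (C \o -%R) (Y \o -%R) = rev_dual_service Y C \o -%R /\
  dual_service (C \o -%R) (Y \o -%R) = rev_departure Y C \o -%R.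
Proof.
by split; apply/funext => t;
  rewrite /departure /dual_service /rev_departure /rev_dual_service /=
    !rev_queueE oppr0 opprK.
Qed.

Lemma rev_departure_reversal (R : realType) (Z B : R -> R) :
  rev_departure (B \o -%R) (Z \o -%R) = dual_service Z B \o -%R /\
  rev_dual_service (B \o -%R) (Z \o -%R) = departure Z B \o -%R.
Proof.
by split; apply/funext => t;
  rewrite /departure /dual_service /rev_departure /rev_dual_service /=
    !queueE oppr0 opprK.
Qed.

Lemma comp_opp_inj (R : realType) (f g : R -> R) :
  f \o -%R = g \o -%R -> f = g.
Proof.
by move=> fg; apply/funext => t; have /= := congr1 (@^~ (- t)) fg; rewrite opprK.
Qed.

(** The reversed pair [(C \o -%R, Y \o -%R)] has net service process
    [(Y - C) \o -%R]: the signs from reversing time and from exchanging the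
    roles of the two processes cancel in the limits at infinity. *)
Lemma backward_inversion (R : realType) (Y C : R -> R) :
  continuous Y -> continuous C ->
  (C t - Y t) @[t --> +oo] --> -oo -> (C t - Y t) @[t --> -oo] --> +oo ->
  [/\ queue (rev_departure Y C) (rev_dual_service Y C) = rev_queue Y C,
      departure (rev_departure Y C) (rev_dual_service Y C) = Y &
      dual_service (rev_departure Y C) (rev_dual_service Y C) = C].
Proof.
move=> cY cC CYp CYn.
have cR (f : R -> R) : continuous f -> continuous (f \o -%R).
  by move=> cf x; apply: continuous_comp; [exact: oppr_continuous|exact: cf].
have YCE : (fun t => (Y \o -%R) t - (C \o -%R) t) =
    (- (fun t => C t - Y t)) \o -%R.
  by apply/funext => t /=; rewrite /GRing.opp /= opprB.
have lp : ((Y \o -%R) t - (C \o -%R) t) @[t --> +oo] --> -oo.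
  by rewrite YCE; apply/(cvgNy_compNP (- (fun t => C t - Y t)))/cvgNrNy.
have ln : ((Y \o -%R) t - (C \o -%R) t) @[t --> -oo] --> +oo.
  by rewrite YCE; apply/(cvgy_compNP (- (fun t => C t - Y t)))/cvgNry.
have [dep dual] := departure_reversal Y C.
have := rev_queue_departure (cR _ cC) (cR _ cY) lp ln.
have := rev_departureK (cR _ cC) (cR _ cY) lp ln.
rewrite dep dual => -[].
have [-> ->] := rev_departure_reversal (rev_departure Y C) (rev_dual_service Y C).
move=> /comp_opp_inj dualK /comp_opp_inj depK queueK; split=> //.
by apply/funext => t; rewrite queueE queueK rev_queueE.
Qed.

Theorem theoremD1 (R : realType) (Z B Y C : R -> R)
  (cZ : continuous Z) (cB : continuous B)
  (cY : continuous Y) (cC : continuous C)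
  (Z0 : Z 0 = 0) (B0 : B 0 = 0) (Y0 : Y 0 = 0) (C0 : C 0 = 0)
  (BZ_pinfty : (B t - Z t) @[t --> +oo] --> -oo)
  (BZ_ninfty : (B t - Z t) @[t --> -oo] --> +oo)
  (CY_pinfty : (C t - Y t) @[t --> +oo] --> -oo)
  (CY_ninfty : (C t - Y t) @[t --> -oo] --> +oo) :
  ((Y = departure Z B /\ C = dual_service Z B) <->
   (Z = rev_departure Y C /\ B = rev_dual_service Y C)) /\
  ((Y = departure Z B /\ C = dual_service Z B) \/
   (Z = rev_departure Y C /\ B = rev_dual_service Y C) ->
   queue Z B = rev_queue Y C).
Proof.
have fwdK := rev_departureK cZ cB BZ_pinfty BZ_ninfty.
have fwdQ := rev_queue_departure cZ cB BZ_pinfty BZ_ninfty.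
have [bwdQ bwdD bwdR] := backward_inversion cY cC CY_pinfty CY_ninfty.
split; last by move=> [[-> ->]|[-> ->]].
split=> [[-> ->]|[-> ->]].
  by have [-> ->] := fwdK.
by rewrite bwdD bwdR.
Qed.
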